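(* Let $n\geq 3$ and $m\geq 2n$ be integers and let $p=\frac{1}{2}\binom{2n}{n}-1$. Then $$\operatorname{rank} H_p\big(\mathcal{VR}(\mathcal{F}_n^{[m]};2(n-1))\big)\geq\binom{m}{2n}.$$ Equivalently, since $\mathcal{VR}(\mathcal{F}_n^{[2n+k]};2(n-1))=\operatorname{Ind}(\mathrm{KG}(n,k))$, the $p$-dimensional homology of the independence complex of the Kneser graph $\mathrm{KG}(n,k)$ has rank at least $\binom{2n+k}{2n}$ for every $k\ge 0$.
   Context: $[m]=\{1,\dots,m\}$. $\mathcal{F}_n^{[m]}$ is the set of $n$-element subsets of $[m]$ with metric $d(A,B)=|A\triangle B|$. For a metric space $(X,d)$ and $r\ge 0$, $\mathcal{VR}(X;r)$ is the simplicial complex on $X$ whose simplices are the nonempty finite $\tau\subseteq X$ with $d(x,y)\le r$ for all $x,y\in\tau$. The Kneser graph $\mathrm{KG}(n,k)$ has vertex set the $n$-subsets of $[2n+k]$, two being adjacent iff disjoint; $\operatorname{Ind}(G)$ is the simplicial complex of independent vertex sets of $G$. Homology is simplicial homology (with real coefficients; rank means dimension). *)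

(* Defs.v *)
From HB Require Import structures.
From mathcomp Require Import all_boot all_order all_algebra.
From mathcomp Require Import generic_quotient ring_quotient.

Set Implicit Arguments.
Unset Strict Implicit.
Unset Printing Implicit Defensive.
Set Warnings "-redundant-canonical-projection".

Import GRing.Theory.
Local Open Scope ring_scope.
Local Open Scope quotient_scope.

Section QuotientSpace.
Variables (F : fieldType) (V : vectType F) (U : {vspace V}).

Definition quotv := Quotient.quot (pred_of_vspace U).

HB.instance Definition _ := GRing.Zmodule.on quotv.

Definition to_quotv (v : V) : quotv := \pi_(Quotient.quot (pred_of_vspace U)) v.

Lemma to_quotv_eq v w : (to_quotv v == to_quotv w) = (v - w \in U).
Proof. by rewrite Quotient.idealrBE. Qed.

Lemma to_quotvD : {morph to_quotv : v w / v + w}.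
Proof. by move=> v w; rewrite /to_quotv raddfD. Qed.

Lemma to_quotvK x : to_quotv (repr x) = x.
Proof. exact: reprK. Qed.

Definition quotv_scale (a : F) (x : quotv) : quotv := to_quotv (a *: repr x).

Lemma quotv_scale_pi a v : quotv_scale a (to_quotv v) = to_quotv (a *: v).
Proof.
apply/eqP; rewrite to_quotv_eq -scalerBr memvZ //.
by rewrite -to_quotv_eq to_quotvK.
Qed.

Fact quotv_scaleA a b x :
  quotv_scale a (quotv_scale b x) = quotv_scale (a * b) x.
Proof. by rewrite -[x]to_quotvK !quotv_scale_pi scalerA. Qed.

Fact quotv_scale1 : left_id 1 quotv_scale.
Proof. by move=> x; rewrite -[x]to_quotvK quotv_scale_pi scale1r. Qed.

Fact quotv_scaleDr : right_distributive quotv_scale +%R.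
Proof.
move=> a x y; rewrite -[x]to_quotvK -[y]to_quotvK -to_quotvD !quotv_scale_pi.
by rewrite scalerDr to_quotvD.
Qed.

Fact quotv_scaleDl x : {morph quotv_scale^~ x : a b / a + b}.
Proof.
by move=> a b; rewrite -[x]to_quotvK !quotv_scale_pi scalerDl to_quotvD.
Qed.

HB.instance Definition _ := GRing.Zmodule_isLmodule.Build F quotv
  quotv_scaleA quotv_scale1 quotv_scaleDr quotv_scaleDl.

Lemma to_quotv_is_linear : linear to_quotv.
Proof. by move=> a v w; rewrite to_quotvD -quotv_scale_pi. Qed.

HB.instance Definition _ :=
  GRing.isLinear.Build F V quotv _ to_quotv to_quotv_is_linear.

Fact quotv_vect_iso : Vector.axiom (\dim U^C) quotv.
Proof.
have UCU : (U^C :&: U = 0)%VS by rewrite capvC capv_compl.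
pose pr := daddv_pi U^C U.
have prP v : v - pr v \in U.
  have vE : pr v + daddv_pi U U^C v = v.
    by rewrite daddv_pi_add // addvC addv_complf memvf.
  by rewrite -{1}vE addrC addKr memv_pi.
have pr0 v : v \in U -> pr v = 0.
  move=> Uv; apply/eqP; rewrite -memv0 -UCU memv_cap memv_pi /=.
  by rewrite -[pr v](subKr v) rpredB.
have pr_repr v : pr (repr (to_quotv v)) = pr v.
  apply/eqP; rewrite -subr_eq0; apply/eqP.
  rewrite -[LHS](linearB pr); apply: pr0.
  by rewrite -to_quotv_eq to_quotvK.
exists (fun x => \row_i coord (vbasis U^C) i (pr (repr x))).
  move=> a x y; apply/rowP=> i.
  rewrite -[in LHS](to_quotvK x) -[in LHS](to_quotvK y) -linearP pr_repr.
  by rewrite !mxE !linearP.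
exists (fun r : 'rV_(\dim U^C) => to_quotv (\sum_i r 0 i *: (vbasis U^C)`_i)).
  move=> x; rewrite -[RHS]to_quotvK; apply/eqP; rewrite to_quotv_eq.
  rewrite (eq_bigr (fun i => coord (vbasis U^C) i (pr (repr x)) *:
                             (vbasis U^C)`_i)) => [|i _]; last by rewrite mxE.
  by rewrite -coord_vbasis ?memv_pi // -memvN opprB.
move=> r; apply/rowP=> i; rewrite mxE pr_repr.
have UCs : \sum_j r 0 j *: (vbasis U^C)`_j \in (U^C)%VS.
  by apply: rpred_sum => j _; rewrite rpredZ ?vbasis_mem ?memt_nth.
by rewrite daddv_pi_id // coord_sum_free ?(basis_free (vbasisP _)).
Qed.

HB.instance Definition _ := Lmodule_hasFinDim.Build F quotv quotv_vect_iso.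

Lemma dim_quotv : \dim {:quotv} = (\dim {:V} - \dim U)%N.
Proof. by rewrite dimvf -dimv_compl. Qed.

End QuotientSpace.

Definition rank (F : fieldType) (V : vectType F) : nat := \dim {:V}.

Section SimplicialComplex.
Variable T : finType.

Definition is_scomplex (K : {set {set T}}) : bool :=
  (set0 \notin K) &&
  [forall s in K, forall t : {set T}, (t != set0) && (t \subset s) ==> (t \in K)].

Record scomplex :=
  SComplex { simplices :> {set {set T}}; _ : is_scomplex simplices }.

HB.instance Definition _ := [isSub for simplices].

Lemma scomplex0 (K : scomplex) : set0 \notin K.
Proof. by case: K => K /= /andP[]. Qed.

Lemma scomplex_face (K : scomplex) s t :
  s \in K -> t != set0 -> t \subset s -> t \in K.
Proof.
case: K => K /= /andP[_ /forall_inP Kc] Ks t0 ts.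
by move/forallP/(_ t)/implyP: (Kc s Ks); apply; rewrite t0.
Qed.

End SimplicialComplex.

Section Homology.
Variables (F : fieldType) (T : finType) (K : scomplex T).

(* [k] counts vertices: these are the simplices of dimension [k - 1], and there
   are none for [k = 0], so that the homology below is not reduced. *)
Definition ksimplex (k : nat) := {s : {set T} | (s \in K) && (#|s| == k)}.
HB.instance Definition _ k := Finite.on (ksimplex k).

Definition chains (k : nat) := {ffun ksimplex k -> F^o}.
HB.instance Definition _ k := Vector.on (chains k).

(* Simplices are oriented by the order in which [T] is enumerated: a simplex
   [v_0 < ... < v_p] has boundary the sum of [(-1) ^+ i] times its [i]-th face. *)
Definition position (v : T) (s : {set T}) : nat :=
  #|[set w in s | (enum_rank w < enum_rank v)%N]|.

Definition boundary_fun (k : nat) (c : chains k.+1) : chains k :=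
  [ffun t : ksimplex k => \sum_(s : ksimplex k.+1) \sum_(v in val s | val s :\ v == val t)
               (-1) ^+ position v (val s) * c s].

Fact boundary_fun_is_linear k : linear (@boundary_fun k).
Proof.
move=> a c d; apply/ffunP=> t; rewrite !ffunE scaler_sumr -big_split /=.
apply: eq_bigr => s _; rewrite scaler_sumr -big_split /=.
apply: eq_bigr => v _; rewrite !ffunE mulrDr; congr (_ + _).
by rewrite /GRing.scale /= mulrCA.
Qed.

HB.instance Definition _ k :=
  GRing.isLinear.Build F (chains k.+1) (chains k) _ (@boundary_fun k)
    (@boundary_fun_is_linear k).

Definition boundary (k : nat) : 'Hom(chains k.+1, chains k) :=
  linfun (@boundary_fun k).

Definition cycles (p : nat) : {vspace chains p.+1} := lker (boundary p).
Definition boundaries (p : nat) : {vspace chains p.+1} := limg (boundary p.+1).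

(* [vsval] is the inclusion of the cycles into the chains. *)
Definition homology (p : nat) : vectType F :=
  quotv (linfun (@vsval _ _ (cycles p)) @^-1: boundaries p)%VS.

Lemma position_rem (v w : T) (s : {set T}) : w \in s ->
  position v s = (position v (s :\ w) + (enum_rank w < enum_rank v))%N.
Proof.
move=> sw; pose A := [set x in s | (enum_rank x < enum_rank v)%N].
have AD : A :\ w = [set x in s :\ w | (enum_rank x < enum_rank v)%N].
  by apply/setP=> x; rewrite !inE andbA.
by rewrite /position -AD -/A (cardsD1 w A) inE sw addnC.
Qed.

Lemma boundaryK k (c : chains k.+2) : boundary k (boundary k.+1 c) = 0.
Proof.
rewrite !lfunE; apply/ffunP=> t; rewrite !ffunE.
pose G (r : ksimplex k.+2) v w : F :=
  (-1) ^+ (position v (val r :\ w) + position w (val r)) * c r.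
transitivity (\sum_(r : ksimplex k.+2)
    \sum_(w in val r) \sum_(v in val r | (v != w) && (val r :\ w :\ v == val t))
      G r v w).
  under eq_bigr => s _.
    under eq_bigr => v _ do rewrite ffunE mulr_sumr.
    rewrite exchange_big /=; over.
  rewrite exchange_big /=; apply: eq_bigr => r _.
  under eq_bigr => s _.
    under eq_bigr => v _ do rewrite mulr_sumr.
    over.
  under eq_bigr => s _ do rewrite exchange_big /=.
  rewrite (exchange_big_dep (fun w => w \in val r)) /=; last first.
    by move=> s w _ /andP[].
  apply: eq_bigr => w rw.
  have /andP[rK /eqP rk] := valP r.
  have sP : (val r :\ w \in K) && (#|val r :\ w| == k.+1).
    have rwk : #|val r :\ w| = k.+1.
      by move: rk; rewrite (cardsD1 w) rw => -[].
    rewrite rwk eqxx andbT (scomplex_face rK) ?subD1set //.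
    by rewrite -card_gt0 rwk.
  rewrite (big_pred1 (Sub (val r :\ w) sP : ksimplex k.+1)) => [|s]; last first.
    by rewrite rw /= -val_eqE /= eq_sym.
  apply: eq_big => [v|v _]; first by rewrite SubK !inE andbA [(v \in _) && _]andbC.
  by rewrite SubK mulrA -exprD.
apply: big1 => r _.
rewrite pair_big_dep /=.
rewrite (bigID (fun p : T * T => enum_rank p.1 < enum_rank p.2)%N) /=.
rewrite addrC (reindex (fun p : T * T => (p.2, p.1))) /=; last first.
  by exists (fun p : T * T => (p.2, p.1)) => -[].
apply/eqP; rewrite addr_eq0 -sumrN; apply/eqP; apply: eq_big => [[w v]|[w v]] /=.
  have [->|vw] := eqVneq v w; first by rewrite !andbF ltnn andbF.
  rewrite -leqNgt leq_eqVlt (inj_eq val_inj) (inj_eq enum_rank_inj).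
  rewrite [w == v]eq_sym (negPf vw) /= setDDl setUC -setDDl.
  by case: (v \in _); case: (w \in _).
case/andP=> /and4P[rw rv wv _]; rewrite -leqNgt leq_eqVlt (inj_eq val_inj).
rewrite (inj_eq enum_rank_inj) (negPf wv) /= => ltwv.
rewrite /G (position_rem v rv) (position_rem w rw) ltwv ltnNge (ltnW ltwv) /=.
by rewrite addn0 addnA addn1 exprS !mulN1r mulNr [in LHS]addnC.
Qed.

Lemma sub_boundaries_cycles p : (boundaries p <= cycles p)%VS.
Proof.
by apply/subvP=> _ /memv_imgP[c _ ->]; rewrite memv_ker boundaryK.
Qed.

Lemma dim_homology p :
  rank (homology p) = (\dim (cycles p) - \dim (boundaries p))%N.
Proof.
pose i : 'Hom(subvs_of (cycles p), chains p.+1) := linfun vsval.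
rewrite /rank dim_quotv dimvf; congr (_ - _)%N.
have i0 : lker i == 0%VS by apply/lker0P=> x y; rewrite !lfunE; apply: val_inj.
have im : limg i = cycles p.
  apply/vspaceP=> c; apply/memv_imgP/idP => [[x _ ->]|Zc].
    by rewrite lfunE; apply: subvsP.
  by exists (vsproj _ c); rewrite ?memvf // lfunE /= vsprojK.
rewrite -(limg_dim_eq (f := i)) ?(eqP i0) ?capv0 // lpreimK //.
by rewrite im sub_boundaries_cycles.
Qed.

End Homology.

Local Open Scope nat_scope.

Section VietorisRips.
Variables (X : finType) (d : X -> X -> nat) (r : nat).

Definition VR_simplices : {set {set X}} :=
  [set s : {set X} | (s != set0) && [forall x in s, forall y in s, d x y <= r]].

Fact VR_is_scomplex : is_scomplex VR_simplices.
Proof.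
rewrite /is_scomplex inE eqxx /=; apply/forall_inP=> s; rewrite inE => /andP[_ sr].
apply/forallP=> t; apply/implyP=> /andP[t0 /subsetP ts]; rewrite inE t0 /=.
apply/forall_inP=> x tx; apply/forall_inP=> y ty.
by move/forall_inP/(_ x (ts x tx))/forall_inP: sr; apply; apply: ts.
Qed.

Definition VR : scomplex X := SComplex VR_is_scomplex.

End VietorisRips.

Section IndependenceComplex.
Variables (X : finType) (adj : rel X).

Definition Ind_simplices : {set {set X}} :=
  [set s : {set X} | (s != set0) && [forall x in s, forall y in s, ~~ adj x y]].

Fact Ind_is_scomplex : is_scomplex Ind_simplices.
Proof.
rewrite /is_scomplex inE eqxx /=; apply/forall_inP=> s; rewrite inE => /andP[_ si].
apply/forallP=> t; apply/implyP=> /andP[t0 /subsetP ts]; rewrite inE t0 /=.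
apply/forall_inP=> x tx; apply/forall_inP=> y ty.
by move/forall_inP/(_ x (ts x tx))/forall_inP: si; apply; apply: ts.
Qed.

Definition Ind : scomplex X := SComplex Ind_is_scomplex.

End IndependenceComplex.

(* The [n]-subsets of an [m]-element set, here ['I_m] rather than {1, ..., m}. *)
Definition nsubsets (n m : nat) := {A : {set 'I_m} | #|A| == n}.
HB.instance Definition _ n m := Finite.on (nsubsets n m).

Definition symdist (n m : nat) (A B : nsubsets n m) : nat :=
  #|(val A :\: val B) :|: (val B :\: val A)|.

(* Adjacency in the Kneser graph KG(n, k), for n > 0. *)
Definition kneser (n k : nat) : rel (nsubsets n (2 * n + k)) :=
  fun A B => [disjoint val A & val B].

(* Main.v *)
(** For a [2n]-subset [S], the [n]-subsets of [S] span a cross-polytope boundary of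
    dimension [p], whose antipodal pairs are the complementary pairs in [S]; let [c_S]
    be its fundamental cycle. A facet [s_S] of this sphere that is a maximal simplex of
    the whole complex carries no boundary, so the coefficient at [s_S] is a functional
    on homology. If moreover the members of [s_S] cover [S], then [s_S] lies in no other
    sphere, and these functionals are, up to signs, dual to the [c_S]. Maximality of
    [s_S] means that every [n+1]-subset of [S] contains a member of [s_S]; the [n]-subsets
    avoiding a fixed point [x] have this property, but do not cover [S], and exchanging
    two suitable ones for their complements repairs this when [n >= 3]. *)
From HB Require Import structures.
Require Import Defs.
From mathcomp Require Import all_boot all_order all_algebra reals zify.

Import GRing.Theory Num.Theory.

Set Implicit Arguments.
Unset Strict Implicit.
Unset Printing Implicit Defensive.

(** * Maximal simplices as functionals on homology *)

Section MaximalSimplices.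
Local Open Scope ring_scope.
Variables (F : fieldType) (T : finType) (K : scomplex T).

(** Only simplices properly containing [t] could contribute to this coefficient. *)
Lemma boundary_maximal k (c : chains F K k.+1) (t : ksimplex K k) :
  (forall u, u \in K -> val t \subset u -> u = val t) ->
  boundary F K k c t = 0.
Proof.
move=> tmax; rewrite lfunE ffunE big1 // => s _; rewrite big1 // => v /andP[sv /eqP st].
have /andP[sK _] := valP s.
have := tmax _ sK; rewrite -st subD1set => /(_ isT) sE.
by move: sv; rewrite sE !inE eqxx.
Qed.

(** Reading off the coefficients at the [s i] kills boundaries by maximality, and it maps the cycles
    onto a space of dimension [#|I|] because the [c i] are dual to the [s i] up to nonzero
    scalars. *)
Lemma leq_card_rank_homology (I : finType) p (c : I -> chains F K p.+1)
    (s : I -> ksimplex K p.+1) :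
    (forall i, c i \in cycles F K p) ->
    (forall i u, u \in K -> val (s i) \subset u -> u = val (s i)) ->
    (forall i j, (c i (s j) == 0) = (i != j)) ->
  (#|I| <= rank (homology F K p))%N.
Proof.
move=> Zc smax cs; rewrite dim_homology.
pose ev (b : chains F K p.+1) : {ffun I -> F^o} := [ffun i => b (s i)].
have ev_lin : linear ev by move=> a x y; apply/ffunP=> i; rewrite !ffunE.
pose evL := GRing.isLinear.Build _ _ _ _ ev ev_lin.
pose evl : {linear chains F K p.+1 -> {ffun I -> F^o}} := HB.pack ev evL.
pose f := linfun evl.
have fZ : (f @: cycles F K p)%VS = fullv.
  apply/eqP; rewrite eqEsubv subvf; apply/subvP=> g _.
  apply/memv_imgP; exists (\sum_i (g i / c i (s i)) *: c i).
    by apply: rpred_sum => i _; rewrite rpredZ.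
  apply/ffunP=> j; rewrite lfunE /= /ev ffunE sum_ffunE (bigD1 j) //= big1 => [|i ij].
    by rewrite ffunE addr0 /GRing.scale /= divfK // cs eqxx.
  have /eqP c0 : c i (s j) == 0 by rewrite cs.
  by rewrite ffunE c0 scaler0.
have := limg_ker_dim f (cycles F K p); rewrite fZ dimvf /dim /= muln1 => <-.
(* By rank-nullity it remains to place the boundaries inside the kernel of [f] on cycles. *)
rewrite addnC -addnBA ?leq_addr //.
apply: dimvS; rewrite subv_cap sub_boundaries_cycles; apply/subvP=> _ /memv_imgP[b _ ->].
rewrite memv_ker; apply/eqP/ffunP=> i; rewrite lfunE /= !ffunE.
exact: boundary_maximal (smax i).
Qed.

End MaximalSimplices.

(** * The fundamental cycle of a cross-polytope boundary *)

Section CrossPolytope.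
Variables (T : finType) (opp : T -> T) (V : {set T}).
Hypothesis oppK : involutive opp.

(** Facets of the cross-polytope boundary with antipodal map [opp]. If [opp] fixes a point of [V],
    there are none. *)
Definition facet (s : {set T}) : bool :=
  (s \subset V) && [forall v in V, (opp v \in s) == (v \notin s)].

Hypothesis oppV : forall v, v \in V -> opp v \in V.

Lemma facet_opp s v : facet s -> v \in V -> (opp v \in s) = (v \notin s).
Proof. by case/andP=> _ /forall_inP sV /sV/eqP. Qed.

Lemma card_facet s : facet s -> #|s|.*2 = #|V|.
Proof.
move=> sf; have /andP[sV _] := sf.
rewrite -addnn -{2}(card_imset _ (inv_inj oppK)).
rewrite -(cardsID s V) (setIidPr sV); congr (_ + #|pred_of_set _|).
apply/setP=> v; rewrite inE; apply/imsetP/andP => [[w sw ->]|[vs Vv]].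
  by rewrite (facet_opp sf) ?oppV ?(subsetP sV) // negbK.
by exists (opp v); rewrite ?oppK // (facet_opp sf).
Qed.

(** Antipodal swap across the ridge [t], the source of the cancellation in the boundary. *)
Lemma facet_swap v (t : {set T}) :
  v \notin t -> facet (v |: t) -> opp v \notin t /\ facet (opp v |: t).
Proof.
move=> tv sf; have /andP[/subsetP sV _] := sf.
have Vv : v \in V by rewrite sV ?setU11.
have := facet_opp sf Vv; rewrite setU11 => /negbT.
rewrite !inE negb_or => /andP[ov ovt]; split=> //.
apply/andP; split.
  apply/subsetP=> w; rewrite !inE => /predU1P[->|wt]; first exact: oppV.
  by rewrite sV // setU1r.
apply/forall_inP=> w Vw; have := facet_opp sf Vw; rewrite !inE (inj_eq (inv_inj oppK)).
rewrite (inv_eq oppK).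
have [->|wv] := eqVneq w v; first by rewrite (negPf tv) (negPf ovt) eq_sym (negPf ov).
have [->|wov] := eqVneq w (opp v).
  by rewrite oppK (negPf tv).
by move=> /= ->.
Qed.

(** [key] is shared by the two members of a pair; [neg] marks the one with coefficient -1 in the
    factor of that pair. *)
Let key v := minn (enum_rank v) (enum_rank (opp v)).
Let neg v := enum_rank (opp v) < enum_rank v.

(* The sign, relative to the order of [T], of the monomial [s] in the exterior
   product of the [v - opp v], the pairs being ordered by [key]. *)
Definition orientation (s : {set T}) : nat :=
  \sum_(u in s) (neg u + \sum_(v in s) ((key u < key v) && (enum_rank v < enum_rank u))).

Lemma keyK v : key (opp v) = key v.
Proof. by rewrite /key oppK minnC. Qed.

Lemma key_inj u v : key u = key v -> u = v \/ u = opp v.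
Proof.
have ord_inj2 x y : enum_rank x = enum_rank y :> nat -> x = y.
  by move=> /val_inj/enum_rank_inj.
rewrite /key /minn; case: ifP => _; case: ifP => _ /ord_inj2; first by left.
- by right.
- by right; rewrite -[u]oppK; congr opp.
by left; apply: inv_inj oppK _ _ _.
Qed.

(** Apart from [neg v], the right-hand side sees [v] only through its [key], so replacing [v] by
    [opp v] flips the sign. *)
Lemma odd_orientationU1 v (t : {set T}) : v \notin t -> opp v \notin t ->
  odd (orientation (v |: t) + position v (v |: t)) =
  neg v (+) odd (orientation t + \sum_(w in t) (key w < key v)).
Proof.
move=> tv tov.
have posE : position v (v |: t) = \sum_(w in t) (enum_rank w < enum_rank v).
  rewrite /position -sum1_card big_mkcond [RHS]big_mkcond /=; apply: eq_bigr => w _.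
  rewrite !inE; have [->|_] := eqVneq w v; first by rewrite ltnn (negPf tv).
  by case: (w \in t) => //=; case: ltnP.
have oE : orientation (v |: t) = orientation t + neg v +
   (\sum_(w in t) ((key v < key w) && (enum_rank w < enum_rank v)) +
    \sum_(w in t) ((key w < key v) && (enum_rank v < enum_rank w))).
  rewrite /orientation big_setU1 //= big_setU1 //= !ltnn add0n.
  under [X in _ + X = _]eq_bigr => u _ do rewrite big_setU1 //= addnCA.
  by rewrite big_split /=; lia.
(* For each [w], the first two terms record whether the key order and the rank order of [v] and [w]
   disagree; adding the rank comparison modulo 2 leaves the key comparison. *)
suff sE : odd (\sum_(w in t) ((key v < key w) && (enum_rank w < enum_rank v)) +
    \sum_(w in t) ((key w < key v) && (enum_rank v < enum_rank w)) +
    \sum_(w in t) (enum_rank w < enum_rank v)) = odd (\sum_(w in t) (key w < key v)).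
  rewrite posE oE -addnA oddD [odd (_ + neg v)]oddD sE oddb !oddD.
  by rewrite addbAC [_ (+) neg v]addbC addbA.
rewrite -!big_split /= !(big_morph odd oddD (erefl _)); apply: eq_bigr => w tw.
have wv : w != v by apply: contraNneq tv => <-.
have kwv : key w != key v.
  by apply/eqP=> /key_inj[] E; [rewrite E eqxx in wv|rewrite -E tw in tov].
have rwv : enum_rank w != enum_rank v :> nat.
  by rewrite (inj_eq val_inj) (inj_eq enum_rank_inj).
by case: ltngtP kwv rwv => // _ _; case: ltngtP.
Qed.

Local Open Scope ring_scope.
Variables (F : numFieldType) (K : scomplex T).

Definition cross_polytope k : chains F K k :=
  [ffun s => if facet (val s) then (-1) ^+ orientation (val s) else 0].

Lemma cross_polytope_eq0 k s : (cross_polytope k s == 0) = ~~ facet (val s).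
Proof. by rewrite ffunE; case: ifP => _; rewrite ?eqxx // signr_eq0. Qed.

Lemma cross_polytope_cycle p : {subset facet <= K} ->
  cross_polytope p.+1 \in cycles F K p.
Proof.
move=> fK; rewrite memv_ker; apply/eqP/ffunP=> t; rewrite lfunE !ffunE.
pose P v := (v \notin val t) && facet (v |: val t).
pose G v : F := (-1) ^+ (position v (v |: val t) + orientation (v |: val t)).
(* The coefficient at [t] is a sum over the vertices completing [t] to a facet, on which [opp] is a
   sign-reversing involution. *)
transitivity (\sum_(v | P v) G v); last first.
  have PN v : P v -> P (opp v).
    by case/andP=> vt vf; rewrite /P; have [-> ->] := facet_swap vt vf.
  have GN v : P v -> G (opp v) = - G v.
    case/andP=> vt vf; have [ovt ovf] := facet_swap vt vf.
    have vov : v != opp v.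
      apply/eqP=> vov; have /andP[/subsetP/(_ v (setU11 _ _)) Vv _] := vf.
      by have := facet_opp vf Vv; rewrite -vov; case: (v \in _).
    have nov : neg (opp v) = ~~ neg v.
      rewrite /neg oppK -leqNgt [RHS]leq_eqVlt (inj_eq val_inj) (inj_eq enum_rank_inj).
      by rewrite (negPf vov).
    rewrite /G -signr_odd -[in RHS]signr_odd ![(position _ _ + _)%N]addnC.
    by rewrite !odd_orientationU1 ?oppK // keyK nov addNb signrN.
  (* In a [numFieldType], a sum equal to its own opposite vanishes. *)
  apply/eqP; rewrite -eqNr -sumrN; apply/eqP.
  rewrite [RHS](reindex_inj (inv_inj oppK)) /=.
  apply: eq_big => [v|v /GN->//].
  by apply/idP/idP => /PN; rewrite ?oppK.
under eq_bigr => s _ do rewrite big_mkcond /=.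
rewrite exchange_big [RHS]big_mkcond /=; apply: eq_bigr => v _.
rewrite -big_mkcond /=; case: ifP => [/andP[vt vf]|Pv]; last first.
  apply: big1 => s /andP[sv /eqP/esym st]; rewrite ffunE.
  case: ifP => [sf|]; last by rewrite mulr0.
  by rewrite /P [val t]st setD1K // sf !inE eqxx in Pv.
have sP : (v |: val t \in K) && (#|v |: val t| == p.+1).
  have /andP[_ /eqP tp] := valP t.
  by rewrite fK //= cardsU1 vt tp.
rewrite (big_pred1 (Sub (v |: val t) sP : ksimplex K p.+1)) => [|s].
  by rewrite ffunE SubK vf -exprD.
apply/andP/eqP => [[sv /eqP/esym st]|->]; last by rewrite /= setU11 setU1K.
by apply: val_inj; rewrite SubK [val t]st setD1K.
Qed.

End CrossPolytope.

(** * The sphere of [n]-subsets of a [2n]-set, and a maximal facet of it *)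

Section Subsets.
Variables (m n : nat) (S : {set 'I_m}).
Hypothesis cardS : #|S| = 2 * n.

Implicit Types A B : nsubsets n m.

Definition nsubsets_in : {set nsubsets n m} := [set A : nsubsets n m | val A \subset S].

(** The identity outside [S] makes this an involution of the whole type. As [#|S| = 2 * n], the
    default of [insubd] is never taken. *)
Definition compl_in A : nsubsets n m := if val A \subset S then insubd A (S :\: val A) else A.

Lemma card_nsubset A : #|val A| = n.
Proof. exact/eqP/(valP A). Qed.

Lemma val_compl_in A : val A \subset S -> val (compl_in A) = S :\: val A.
Proof.
move=> AS; rewrite /compl_in AS val_insubd cardsD (setIidPr AS) cardS card_nsubset.
by rewrite mul2n -addnn addnK eqxx.
Qed.

Lemma compl_inV A : A \in nsubsets_in -> compl_in A \in nsubsets_in.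
Proof. by rewrite !inE => AS; rewrite val_compl_in // subsetDl. Qed.

Lemma compl_inK : involutive compl_in.
Proof.
move=> A; case: (boolP (val A \subset S)) => AS; last first.
  by rewrite {2}/compl_in (negPf AS) /compl_in (negPf AS).
apply: val_inj; rewrite val_compl_in ?val_compl_in ?subsetDl //.
by rewrite setDDr setDv set0U (setIidPr AS).
Qed.

Lemma compl_in_disjoint A B : A \in nsubsets_in -> B \in nsubsets_in ->
  [disjoint val A & val B] = (B == compl_in A).
Proof.
rewrite !inE => AS BS; rewrite -val_eqE /= val_compl_in //.
apply/idP/eqP => [AB|->]; last by rewrite -setI_eq0 setIDA (setIidPl AS) setDv.
apply/eqP; rewrite eqEcard subsetD BS disjoint_sym AB /=.
by rewrite -val_compl_in // !card_nsubset.
Qed.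

Lemma card_nsubsets_in : #|nsubsets_in| = 'C(2 * n, n).
Proof.
rewrite -cardS -cards_draws -(card_imset _ val_inj); apply: eq_card => A.
rewrite inE; apply/imsetP/andP => [[B BS ->]|[AS An]].
  by rewrite inE in BS; rewrite BS card_nsubset.
by exists (Sub A An); rewrite ?inE SubK.
Qed.

Notation facetS := (facet compl_in nsubsets_in).

Lemma card_facetS s : facetS s -> #|s| = 'C(2 * n, n) %/ 2.
Proof.
move=> sf; rewrite -card_nsubsets_in -(card_facet compl_inK compl_inV sf).
by rewrite -mul2n mulKn.
Qed.

Lemma facetS_intersecting s A B : facetS s -> A \in s -> B \in s ->
  ~~ [disjoint val A & val B].
Proof.
move=> sf sA sB; have /andP[/subsetP sV _] := sf.
rewrite compl_in_disjoint ?sV //; apply: contraTneq sB => ->.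
by rewrite (facet_opp sf) ?sV // negbK.
Qed.

(* A complementary pair contributes its member avoiding [x], except for the two
   pairs [{x |: Di, a |: Dj}], which contribute [x |: Di]. *)
Lemma exists_maximal_facet : 3 <= n -> exists s : {set nsubsets n m},
  [/\ facetS s,
      forall B, B \notin s -> exists2 A, A \in s & [disjoint val A & val B]
    & S \subset \bigcup_(A in s) val A].
Proof.
move=> n3.
have [x Sx] : exists x, x \in S by apply/card_gt0P; lia.
have [a] : exists a, a \in S :\ x.
  by apply/card_gt0P; move: (cardsD1 x S); rewrite Sx; lia.
rewrite inE in_set1 => /andP[ax Sa].
have SaxE : #|S :\ x :\ a| = 2 * n - 2.
  by move: (cardsD1 x S) (cardsD1 a (S :\ x)); rewrite !inE ax Sx Sa; lia.
have [D [DS cD]] : exists D : {set 'I_m}, D \subset S :\ x :\ a /\ #|D| = n.-1.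
  have : 0 < #|[set D : {set 'I_m} | D \subset S :\ x :\ a & #|D| == n.-1]|.
    by rewrite cards_draws bin_gt0; lia.
  by case/card_gt0P=> D; rewrite inE => /andP[? /eqP ?]; exists D.
pose E := S :\ x :\ a :\: D.
have cE : #|E| = n.-1 by rewrite cardsD (setIidPr DS); lia.
have EE z : (z \in E) = [&& z \notin D, z != a, z != x & z \in S] by rewrite !inE.
have DSE z : z \in D -> [&& z != a, z != x & z \in S].
  by move/(subsetP DS); rewrite !inE.
have xD : x \notin D by apply/negP=> /DSE; rewrite eqxx andbF.
have aD : a \notin D by apply/negP=> /DSE; rewrite eqxx.
have xE : x \notin E by rewrite EE eqxx !andbF.
have aE : a \notin E by rewrite EE eqxx !andbF.
(* The two exceptional complementary pairs; the exclusive or with [Q] in [s] reverses the choice on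
   them. *)
pose Q : {set {set 'I_m}} := [set x |: D; x |: E; a |: D; a |: E].
pose s := [set A : nsubsets n m | (val A \subset S) && ((x \notin val A) (+) (val A \in Q))].
have inS (A : {set 'I_m}) : A \subset S -> #|A| = n ->
  (x \notin A) (+) (A \in Q) -> exists2 A' : nsubsets n m, A' \in s & val A' = A.
  by move=> AS /eqP An AQ; exists (Sub A An); rewrite ?SubK // inE SubK AS.
have QN (A : {set 'I_m}) : x \notin A -> a \notin A -> A \notin Q.
  move=> xA aA; rewrite !inE !negb_or -!andbA.
  by apply/and4P; split; apply/eqP=> AE; move: xA aA; rewrite AE !in_setU1 eqxx.
have xDE : S :\: (x |: D) = a |: E.
  apply/setP=> z; rewrite in_setD !in_setU1 EE.
  have [->|za] := eqVneq z a; first by rewrite (negPf ax) (negPf aD) Sa.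
  by case: (z == x); case: (z \in D).
have xED : S :\: (x |: E) = a |: D.
  apply/setP=> z; rewrite in_setD !in_setU1 EE.
  have [->|za] := eqVneq z a; first by rewrite (negPf ax) (negPf aD) Sa.
  case: (boolP (z \in D)) => [/DSE/and3P[_ /negPf-> ->]|_] //=.
  by case: (z == x); case: (z \in S).
have DiS Di : Di \in [:: D; E] -> [/\ x \notin Di, a \notin Di, #|Di| = n.-1,
    x |: Di \in Q & Di \subset S].
  rewrite !inE; case/orP=> /eqP->; split=> //; rewrite ?inE ?eqxx ?orbT //.
    by apply/subsetP=> z /DSE/and3P[].
  by apply/subsetP=> z; rewrite EE => /and4P[].
have DDK (A : {set 'I_m}) : A \subset S -> S :\: (S :\: A) = A.
  by move=> AS; rewrite setDDr setDv set0U (setIidPr AS).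
have QC (A : {set 'I_m}) : A \in Q -> S :\: A \in Q.
  rewrite !inE -!orbA; case/or4P=> /eqP->; rewrite ?xDE ?xED ?eqxx ?orbT //.
    rewrite -xED DDK ?eqxx ?orbT // subUset sub1set Sx.
    by case: (DiS E); rewrite ?inE ?eqxx ?orbT.
  rewrite -xDE DDK ?eqxx ?orbT // subUset sub1set Sx.
  by case: (DiS D); rewrite ?inE ?eqxx ?orbT.
have sf : facetS s.
  apply/andP; split; first by apply/subsetP=> A; rewrite !inE => /andP[].
  apply/forall_inP=> A; rewrite inE => AS; apply/eqP.
  rewrite [LHS]inE [in RHS]inE AS val_compl_in // subsetDl /= in_setD Sx andbT.
  have -> : (S :\: val A \in Q) = (val A \in Q).
    by apply/idP/idP => /QC //; rewrite DDK.
  by rewrite -addNb.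
have n1 : n.-1.+1 = n := prednK (ltnW (ltnW n3)).
exists s; split=> // [B sB|].
  case: (boolP (val B \subset S)) => BS.
    have VB : B \in nsubsets_in by rewrite inE.
    exists (compl_in B); first by rewrite (facet_opp sf).
    by rewrite compl_in_disjoint ?compl_inV // compl_inK.
  suff [A sA AC] : exists2 A : nsubsets n m, A \in s & val A \subset S :\: val B.
    by exists A => //; move: AC; rewrite subsetD => /andP[].
  (* As [B] leaves [S], [C] has more than [n] points, so an [n]-subset [A0] of it avoids [x]. It is
     in [s] unless it belongs to [Q]. *)
  set C := S :\: val B.
  have cC : n < #|C|.
    have : #|S :&: val B| < #|val B|.
      by rewrite proper_card // properE subsetIr subsetI (negPf BS).
    by rewrite card_nsubset /C; move: (cardsID (val B) S); clear -cardS; lia.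
  have CS : C \subset S by apply: subsetDl.
  have [A0 AC An] : exists2 A0 : {set 'I_m}, A0 \subset C :\ x & #|A0| = n.
    have : 0 < #|[set A0 : {set 'I_m} | A0 \subset C :\ x & #|A0| == n]|.
      by rewrite cards_draws bin_gt0; move: (cardsD1 x C); clear -cC; lia.
    by case/card_gt0P=> A0; rewrite inE => /andP[? /eqP ?]; exists A0.
  move: AC; rewrite subsetD1 => /andP[AC xA].
  have [AQ|AQ] := boolP (A0 \in Q); last first.
    have [||A sA AE] := inS A0 _ An; rewrite ?(subset_trans AC) ?xA ?(negPf AQ) //.
    by exists A => //; rewrite AE.
  have [Di DiDE A0E] : exists2 Di, Di \in [:: D; E] & A0 = a |: Di.
    move: AQ; rewrite !inE -!orbA; case/or4P=> /eqP A0E.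
    - by rewrite A0E setU11 in xA.
    - by rewrite A0E setU11 in xA.
    - by exists D; rewrite ?inE ?eqxx.
    by exists E; rewrite ?inE ?eqxx ?orbT.
  have [xDi aDi cDi xDiQ _] := DiS _ DiDE.
  (* In the exceptional case [A0 = a |: Di], exchange [a] for a spare point [z] of [C]: the result
     is in [Q] if [z = x], and otherwise avoids both [x] and [a], hence lies outside [Q]. *)
  have [z Cz] : exists2 z, z \in C & z \notin A0.
    by apply/subsetPn; apply/negP=> /subset_leq_card; rewrite An leqNgt cC.
  rewrite A0E !inE negb_or => /andP[za zDi].
  have zC : z |: Di \subset C.
    by rewrite subUset sub1set Cz; move: AC; rewrite A0E subUset => /andP[].
  have [|||A sA AE] := inS (z |: Di).
  - exact: subset_trans zC CS.
  - by rewrite cardsU1 zDi cDi.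
  - have [->|zx] := eqVneq z x; first by rewrite setU11 xDiQ.
    have xz : x \notin z |: Di by rewrite !inE eq_sym (negPf zx).
    by rewrite xz (negPf (QN _ xz _)) // !inE eq_sym (negPf za).
  by exists A => //; rewrite AE.
have cover (A : {set 'I_m}) y : y \in A -> A \subset S -> #|A| = n ->
    (x \notin A) (+) (A \in Q) -> y \in \bigcup_(A in s) val A.
  move=> Ay AS An AQ; have [A' sA AE] := inS A AS An AQ.
  by apply/bigcupP; exists A'; rewrite ?AE.
have xDi Di y : Di \in [:: D; E] -> y \in x |: Di -> y \in \bigcup_(A in s) val A.
  move=> /DiS[xDi aDi cDi xDiQ DiS'] /cover; apply.
  - by rewrite subUset sub1set Sx.
  - by rewrite cardsU1 xDi cDi.
  by rewrite setU11 xDiQ.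
apply/subsetP=> y Sy.
have [yD|yD] := boolP (y \in x |: D); first by apply: xDi yD; rewrite inE eqxx.
have [yE|yE] := boolP (y \in x |: E); first by apply: xDi yE; rewrite !inE eqxx orbT.
have -> : y = a.
  move: yD yE; rewrite !in_setU1 EE Sy.
  by case: (y == x) => //=; case: (y \in D) => //=; rewrite andbT negbK => _ /eqP.
(* To cover [a], take [a |: D] with [d0] exchanged for a point [e] of [E]. The point [e]
   distinguishes it from [a |: D], and a second point [d1] of [D], available since [n >= 3], from
   [a |: E]. *)
have [d0 Dd0] : exists d0, d0 \in D by apply/card_gt0P; rewrite cD; clear -n3; lia.
have [d1] : exists d1, d1 \in D :\ d0 by apply/card_gt0P; move: (cardsD1 d0 D); clear -cD n3; lia.
rewrite !inE => /andP[d10 Dd1].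
have [e Ee] : exists e, e \in E by apply/card_gt0P; rewrite cE; clear -n3; lia.
have /[!EE] /and4P[eD ea ex Se] := Ee.
have dA : a \notin e |: D :\ d0 by rewrite !inE eq_sym (negPf ea) (negPf aD) andbF.
have eA : e \notin D :\ d0 by rewrite !inE (negPf eD) andbF.
have xA : x \notin a |: (e |: D :\ d0).
  by rewrite !inE eq_sym (negPf ax) eq_sym (negPf ex) (negPf xD) andbF.
apply: (cover (a |: (e |: D :\ d0))); rewrite ?setU11 //.
- rewrite !subUset !sub1set Sa Se (subset_trans (subD1set _ _)) //.
  by apply/subsetP=> z /DSE/and3P[].
- by rewrite !cardsU1 dA eA; move: (cardsD1 d0 D); rewrite Dd0 cD; clear -n3; lia.
rewrite xA /= !inE !negb_or -!andbA; apply/and4P; split; apply/eqP=> /setP AE.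
- by have := AE x; rewrite setU11 (negPf xA).
- by have := AE x; rewrite setU11 (negPf xA).
- by have := AE e; rewrite !inE eqxx (negPf ea) (negPf eD).
have := AE d1; rewrite !in_setU1 in_setD1 EE d10 Dd1 !orbT orbF => /esym/eqP d1a.
by rewrite d1a (negPf aD) in Dd1.
Qed.

End Subsets.

(** * Assembling the bound over all [2n]-subsets *)

Section LowerBound.
Variables (F : numFieldType) (n m : nat).
Hypothesis n3 : 3 <= n.

(** The distance is [2 * n] minus twice the size of the intersection. *)
Lemma symdist_leP (A B : nsubsets n m) :
  (symdist A B <= 2 * (n - 1)) = ~~ [disjoint val A & val B].
Proof.
rewrite -setI_eq0 -card_gt0 /symdist cardsU.
have -> : (val A :\: val B) :&: (val B :\: val A) = set0.
  by apply/setP=> z; rewrite !inE; case: (z \in val A); rewrite ?andbF.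
have := cardsID (val B) (val A); have := cardsID (val A) (val B).
by rewrite !card_nsubset cards0 setIC; lia.
Qed.

Lemma mem_VR (s : {set nsubsets n m}) :
  reflect (s != set0 /\ {in s &, forall A B : nsubsets n m, ~~ [disjoint val A & val B]})
    (s \in VR (@symdist n m) (2 * (n - 1))).
Proof.
rewrite inE; apply: (iffP andP) => -[s0 sP]; split=> //.
  by move=> A B sA sB; rewrite -symdist_leP; move/forall_inP/(_ A sA)/forall_inP: sP; apply.
apply/forall_inP=> A sA; apply/forall_inP=> B sB; rewrite symdist_leP; exact: sP.
Qed.

Lemma rank_homology_VR_ge :
  'C(m, 2 * n) <=
    rank (homology F (VR (@symdist n m) (2 * (n - 1))) ('C(2 * n, n) %/ 2 - 1)).
Proof.
pose I := {S : {set 'I_m} | #|S| == 2 * n}.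
have <- : #|{: I}| = 'C(m, 2 * n).
  rewrite card_sig -[in RHS](card_ord m) -cardsT -cards_draws.
  by apply: eq_card => S; rewrite !inE subsetT.
have cI (S : I) : #|val S| = 2 * n := eqP (valP S).
have [s sP] := fin_all_exists (fun S : I => exists_maximal_facet (cI S) n3).
set p := _ %/ _ - 1; set K := VR _ _.
(* The truncated subtraction in [p] is harmless: by Pascal's rule the binomial is a sum of two
   positive terms. *)
have pE : p.+1 = 'C(2 * n, n) %/ 2.
  rewrite /p subn1 prednK // divn_gt0 //.
  case: n n3 => // k _; have -> : 2 * k.+1 = (2 * k).+2 by lia.
  by rewrite binS; apply: (@leq_add 1 1); rewrite bin_gt0; lia.
have fK (S : I) : {subset facet (compl_in (val S)) (nsubsets_in n (val S)) <= K}.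
  move=> t tf; apply/mem_VR; split.
    by rewrite -card_gt0 (card_facetS (cI S) tf) -pE.
  by move=> A B; apply: facetS_intersecting tf.
have sK S : (s S \in K) && (#|s S| == p.+1).
  have [sf _ _] := sP S.
  by rewrite (fK _ _ sf) (card_facetS (cI S) sf) pE eqxx.
pose c (S : I) := cross_polytope (compl_in (val S)) (nsubsets_in n (val S)) F K p.+1.
pose t (S : I) : ksimplex K p.+1 := Sub (s S) (sK S).
apply: (@leq_card_rank_homology F _ K I p c t) => [S|S u|S S'].
- apply: cross_polytope_cycle (fK S).
  + exact: compl_inK (cI S).
  + exact: compl_inV (cI S).
- move=> /mem_VR[_ uI]; rewrite SubK => su; apply/eqP; rewrite eqEsubset su andbT.
  apply/subsetP=> B uB; apply/negPn/negP=> sB.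
  have [_ /(_ B sB)[A sA AB] _] := sP S.
  by move: (uI A B (subsetP su A sA) uB); rewrite AB.
(* If [s S'] is a facet of the sphere of [S], its members lie in [S] and cover [S']; equal
   cardinalities then give [S = S']. *)
rewrite cross_polytope_eq0 SubK; congr (~~ _).
have [sf _ sS] := sP S'.
apply/idP/eqP => [/andP[/subsetP sV _]|->//].
apply/esym/val_inj/eqP; rewrite eqEcard !cI leqnn andbT.
apply: subset_trans sS _; apply/bigcupsP=> A /sV.
by rewrite inE.
Qed.

End LowerBound.

Theorem theorem3p5 (R : realType) (n p : nat) (hn : 3 <= n)
    (hp : p = 'C(2 * n, n) %/ 2 - 1) :
  (forall m : nat, 2 * n <= m ->
     'C(m, 2 * n)
       <= rank (homology R (VR (@symdist n m) (2 * (n - 1))) p)) /\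
  (forall k : nat,
     VR (@symdist n (2 * n + k)) (2 * (n - 1)) = Ind (@kneser n k) /\
     'C(2 * n + k, 2 * n) <= rank (homology R (Ind (@kneser n k)) p)).
Proof.
have VR_Ind k : VR (@symdist n (2 * n + k)) (2 * (n - 1)) = Ind (@kneser n k).
  apply: val_inj; apply/setP=> s; rewrite !inE; congr (_ && _).
  by apply: eq_forallb_in => A _; apply: eq_forallb_in => B _; rewrite symdist_leP.
rewrite hp; split=> [m _|k]; first exact: rank_homology_VR_ge.
split=> //; rewrite -VR_Ind; exact: rank_homology_VR_ge.
Qed.
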